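(* Let $n$ be an integer, let $F$ be an $n$-indexed group with degree map $\deg:F\to\mathbb Z_n$, let $H$ be a subgroup of a group $G$, let $k$ be a positive integer, and let $\Phi$ be a set of homomorphisms from $F$ to $G$ satisfying the following conditions: (i) for all $\varphi\in\Phi$ and $h\in H$, the homomorphism $\psi:f\mapsto\varphi(f)^h=h^{-1}\varphi(f)h$ lies in $\Phi$; (ii) for each $\varphi\in\Phi$, the $\varphi$-core $H_\varphi$ of $H$ contains a subgroup $H_{\varphi,k}$ such that - $H_{\varphi,k}$ is a normal subgroup of $\langle H_\varphi\cup\varphi(F)\rangle$; - $|H_\varphi/H_{\varphi,k}|$ divides $k$; - if $\psi:F\to G$ is a homomorphism coinciding with $\varphi$ on all elements of degree zero and such that $\psi(w)\in\varphi(w)H_{\varphi,k}$ for all elements $w\in F$ whose degrees are multiples of $k$ (i.e. $\deg(w)\in k\mathbb Z_n$), then $\psi\in\Phi$. Then $|\Phi|$ is divisible by $\mathrm{GCD}(H,n)$.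
   Context: Groups are not assumed finite. For $n\in\mathbb Z$, $\mathbb Z_n=\mathbb Z/n\mathbb Z$ (so $\mathbb Z_0=\mathbb Z$). An $n$-indexed group is a group $F$ equipped with an epimorphism $\deg:F\to\mathbb Z_n$, called degree. For a homomorphism $\varphi:F\to G$ from an $n$-indexed group $F$ to a group $G$ containing a subgroup $H$, the $\varphi$-core of $H$ is the subgroup $$H_\varphi=\bigcap_{f\in F}H^{\varphi(f)}\cap C\bigl(\varphi(\ker\deg)\bigr),$$ where $H^{g}=g^{-1}Hg$ and $C(X)$ is the centraliser of $X$ in $G$. In other words, $H_\varphi$ consists of the elements $h\in H$ such that $h^{\varphi(f)}=\varphi(f)^{-1}h\varphi(f)\in H$ for all $f\in F$, and $h^{\varphi(f)}=h$ whenever $\deg f=0$. Divisibility is understood in the sense of cardinal arithmetic: an infinite cardinal is divisible by every nonzero cardinal not exceeding it; zero is divisible by all cardinals and divides only zero. For a group $X$ and an integer $m$, $\mathrm{GCD}(X,m)$ is the least common multiple of the orders of all subgroups of $X$ whose order divides $m$; in particular $\mathrm{GCD}(X,0)=|X|$, and $\mathrm{GCD}(X,m)=\gcd(|X|,m)$ when $X$ is finite. *)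

(* Defs.v *)
From HB Require Import structures.
From mathcomp Require Import all_boot all_algebra all_classical.
From mathcomp Require Import finmap ring_quotient.

Set Implicit Arguments.
Unset Strict Implicit.
Unset Printing Implicit Defensive.
Import GRing.Theory.

Local Open Scope classical_set_scope.
Local Open Scope card_scope.
Local Open Scope group_scope.

Definition Zmod (n : int) : zmodType :=
  Quotient.quot (GRing.ZmodClosed.clone int (dvdz n) _).

(* Divisibility of the cardinal of B by the cardinal of A.  An empty A divides
   only an empty B, since [0 %| b] forces [b = 0]. *)
Definition dvd_card {T U : Type} (A : set T) (B : set U) : Prop :=
  [\/ B = set0,
      exists a b : nat, [/\ A #= `I_a, B #= `I_b & (a %| b)%N]
    | [/\ infinite_set B, A !=set0 & A #<= B]].

(* The cardinal of D is the least common multiple, with respect to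
   [dvd_card], of the cardinals of the members of S. *)
Definition is_card_lcm {T : Type} (S : set (set T)) (D : Type) : Prop :=
  (forall A, S A -> dvd_card A [set: D]) /\
  (forall C : Type,
     (forall A, S A -> dvd_card A [set: C]) -> dvd_card [set: D] [set: C]).

Section Subgroups.
Variable G : groupType.
Implicit Types (H K L X : set G) (g : G).

Definition subgroup H : Prop :=
  [/\ H 1, forall x y, H x -> H y -> H (x * y) & forall x, H x -> H x^-1].

Definition generated X : set G := smallest subgroup X.

Definition conjset H g : set G := [set h ^ g | h in H].

Definition lcoset g H : set G := [set g * h | h in H].

(* L is meant to be a subgroup. *)
Definition normal_in K L : Prop :=
  [/\ subgroup K, K `<=` L & forall x, L x -> conjset K x = K].

Definition quotient_set L K : set (set G) := [set lcoset x K | x in L].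

Definition centraliser X : set G := [set g | forall x, X x -> commute g x].

(* For m = 0 the set [`I_0] is empty, so every subgroup of X qualifies. *)
Definition subgroups_dvd X (m : int) : set (set G) :=
  [set K | [/\ subgroup K, K `<=` X & dvd_card K `I_(absz m)]].

End Subgroups.

Lemma card_eq_dvd_r {T U V : Type} (A : set T) (B : set U) (C : set V) :
  B #= C -> dvd_card A B -> dvd_card A C.
Proof.
move=> BC [B0|[a [b [Aa Bb ab]]]|[iB A0 AB]].
- by apply: Or31; move: BC; rewrite B0 card_eq_sym card_eq0 => /eqP.
- apply: Or32; exists a, b; split=> //.
  by apply: card_eq_trans Bb; rewrite card_eq_sym.
- apply: Or33; split=> //.
    by move=> [n Cn]; apply: iB; exists n; apply: card_eq_trans Cn.
  by rewrite -(card_le_eqr BC).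
Qed.

Lemma card_eq_dvd_l {T U V : Type} (A : set T) (B : set U) (C : set V) :
  A #= B -> dvd_card A C -> dvd_card B C.
Proof.
rewrite card_eq_sym => BA [C0|[a [b [Aa Cb ab]]]|[iC [x Ax] AC]].
- exact: Or31.
- by apply: Or32; exists a, b; split=> //; apply: card_eq_trans Aa.
- apply: Or33; split=> //; last first.
    by rewrite (card_le_eql BA).
  apply/set0P/negP => /eqP B0; move: BA.
  by rewrite B0 card_eq_sym card_eq0 => /eqP A0; rewrite A0 in Ax.
Qed.

Lemma dvd_card_II {T U : Type} (A : set T) (B : set U) (a b : nat) :
  A #= `I_a -> B #= `I_b -> dvd_card A B -> (a %| b)%N.
Proof.
move=> Aa Bb [B0|[a' [b' [Aa' Bb' ab]]]|[iB _ _]].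
- have : `I_b #= `I_0.
    rewrite card_eq_sym in Bb; apply: card_eq_trans Bb _.
    by rewrite B0 II0 card_eq_sym card_eq0.
  by move/card_eq_II => ->.
- suff [-> ->] : a = a' /\ b = b' by [].
  rewrite card_eq_sym in Aa; rewrite card_eq_sym in Bb.
  by split; apply/card_eq_II;
     [exact: card_eq_trans Aa Aa' | exact: card_eq_trans Bb Bb'].
- by case: iB; exists b.
Qed.

Lemma card_eq_undup {T : choiceType} (s : seq T) :
  [set` s] #= `I_(size (undup s)).
Proof.
have -> : [set` s] = [set` seq_fset tt s].
  by apply/seteqP; split=> x; rewrite /mkset seq_fsetE.
by apply/card_eq_fsetP; rewrite size_seq_fset.
Qed.

Section Lagrange.
Variable G : groupType.
Implicit Types (H K X : set G).

Lemma dvd_card_subgroup K X :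
  subgroup K -> subgroup X -> K `<=` X -> dvd_card K X.
Proof.
move=> [K1 KM KV] [X1 XM XV] KX.
have [/finite_seqP[s0 Xs0]|iX] := pselect (finite_set X); last first.
  by apply: Or33; split=> //; [exists 1 | exact: subset_card_le].
pose s := undup s0; have Us : uniq s := undup_uniq s0.
have Xs x : X x <-> x \in s by rewrite Xs0 /= mem_undup.
pose T : finType := seq_sub s.
pose KT := [set u : T | `[< K (ssval u) >]]%SET.
pose R (u v : T) := `[< K ((ssval u)^-1 * ssval v) >].
have divK u v : K u -> K v -> K (u^-1 * v) by move=> *; apply: KM; auto.
have eR : {in [set: T]%SET & &, equivalence_rel R}.
  move=> u v w _ _ _; split; first by apply/asboolP; rewrite mulVg.
  move/asboolP => Kuv; apply/asboolP/asboolP => [Kuw|Kvw].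
    by have := divK _ _ Kuv Kuw; rewrite invgM invgK -mulgA mulVKg.
  by have := KM _ _ Kuv Kvw; rewrite -mulgA mulVKg.
have Pp := equivalence_partitionP eR.
have Pu : {in equivalence_partition R [set: T]%SET,
           forall A : {set T}, #|A| = #|KT|}.
  move=> A /imsetP[u _ ->].
  have Xu : X (ssval u) by apply/Xs/ssvalP.
  have su (v : T) : (ssval u)^-1 * ssval v \in s.
    by apply/Xs/XM; [exact: XV | apply/Xs/ssvalP].
  have inj : injective (fun v : T => SeqSub (su v) : T).
    move=> v w /(congr1 (@ssval _ _)) /= /mulgI vw; exact: val_inj.
  rewrite -(card_imset _ inj); apply: eq_card => w.
  apply/imsetP/idP => [[v + ->]|].
    by rewrite !inE /= /R.
  rewrite inE => /asboolP Kw.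
  have suw : ssval u * ssval w \in s.
    by apply/Xs/XM => //; apply/Xs/ssvalP.
  exists (SeqSub suw); last by apply: val_inj; rewrite /= mulKg.
  by rewrite !inE /R /= mulKg; apply/asboolP.
have := card_uniform_partition Pu Pp.
rewrite cardsT card_seq_sub // => sE.
apply: Or32; exists #|KT|, (size s); split.
- have -> : K = [set` [seq ssval u | u in KT]].
    apply/seteqP; split=> x /=.
      move=> Kx; have xs : x \in s by apply/Xs/KX.
      by apply/mapP; exists (SeqSub xs) => //; rewrite mem_enum inE; apply/asboolP.
    by case/mapP=> u; rewrite mem_enum inE => /asboolP Ku ->.
  have := card_eq_undup [seq ssval u | u in KT].
  rewrite undup_id; first by rewrite size_image.
  by rewrite map_inj_uniq ?enum_uniq //; exact: val_inj.
- by rewrite Xs0; exact: card_eq_undup.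
- by rewrite sE dvdn_mull.
Qed.

End Lagrange.

Section GCD.
Variable G : groupType.
Implicit Types (X : set G) (m : int).

Lemma card_gcd_exists X m : subgroup X ->
  exists D : Type, is_card_lcm (subgroups_dvd X m) D.
Proof.
move=> sX; have [->|m0] := eqVneq m 0%R.
  exists (set_type X); split=> [K [sK KX _]|C CM].
    apply: (card_eq_dvd_r (card_setT_sym X)); exact: dvd_card_subgroup.
  apply: (card_eq_dvd_l (card_setT_sym X)); apply: CM; split=> //.
  by apply: Or31; rewrite II0.
pose M := absz m; have M0 : (0 < M)%N by rewrite absz_gt0.
have noI0 : `I_M <> set0 by move/seteqP => [/(_ 0%N M0)].
pose P (d : 'I_M.+1) :=
  `[< exists K : set G, [/\ subgroups_dvd X m K & K #= `I_d] >].
pose l := (\big[lcmn/1%N]_(d < M.+1 | P d) (d : nat))%N.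
have PM d : P d -> (d %| M)%N.
  by move=> /asboolP[K [[_ _ KM] Kd]]; apply: dvd_card_II KM.
have l0 : (0 < l)%N.
  by apply: (dvdn_gt0 M0); apply/dvdn_biglcmP => d /PM.
have lI : [set: 'I_l] #= `I_l by rewrite card_eq_sym card_II.
exists 'I_l; split=> [K SK|C CM].
  have [sK KX [//|[a [b [Ka bM ab]]]|[iM _ _]]] := SK; last first.
    by case: iM; exists M.
  have aM : (a %| M)%N by move/card_eq_II: bM ab => <-.
  have a_lt : (a < M.+1)%N by rewrite ltnS dvdn_leq.
  apply: Or32; exists a, l; split=> //.
  apply: (@biglcmn_sup _ (Ordinal a_lt)) => //.
  by apply/asboolP; exists K.
have [[c Cc]|iC] := pselect (finite_set [set: C]).
  apply: Or32; exists l, c; split=> //.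
  apply/dvdn_biglcmP => d /asboolP[K [SK Kd]].
  by apply: (dvd_card_II Kd Cc); exact: CM.
apply: Or33; split=> //; first by exists (Ordinal l0).
rewrite (card_le_eql lI); apply: card_le_trans (subset_card_le (@subsetT _ _)) _.
by apply/infiniteP.
Qed.

(* A type of cardinality GCD(X, m); this characterizes it up to bijection, by
   Cantor-Bernstein. *)
Definition GCD X (sX : subgroup X) m : Type := sval (cid (card_gcd_exists m sX)).

Lemma GCDP X (sX : subgroup X) m : is_card_lcm (subgroups_dvd X m) (GCD sX m).
Proof. exact: svalP (cid (card_gcd_exists m sX)). Qed.

End GCD.

Section Indexed.
Variables (n : int) (F G : groupType) (deg : F -> Zmod n).
Implicit Types (phi : {multiplicative F -> G}) (H : set G).

Definition is_degree : Prop :=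
  {morph deg : x y / x * y >-> (x + y)%R} /\ (forall d, exists x, deg x = d).

Definition phi_core phi H : set G :=
  (\bigcap_(f in [set: F]) conjset H (phi f)) `&`
  centraliser (phi @` [set f | deg f = 0%R]).

Definition conj_hom phi (h : G) : F -> G := fun f => phi f ^ h.

Fact conj_hom_is_multiplicative phi h : {morph conj_hom phi h : x y / x * y}.
Proof. by move=> x y; rewrite /conj_hom gmulfM conjMg. Qed.

HB.instance Definition _ phi h :=
  isMultiplicative.Build F G (conj_hom phi h) (conj_hom_is_multiplicative phi h).

End Indexed.

(* Main.v *)
Require Import Defs.
From mathcomp Require Import all_boot all_algebra all_classical.
From mathcomp Require Import ring_quotient generic_quotient.

(** Since [GCD H n] is a least common multiple, it suffices that the order of
    every subgroup [A] of [H] whose order divides [n] divides [|Phi|].  Let [w]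
    have degree [1].  Call [psi] similar to [phi] when they agree on [ker deg]
    and [psi f] lies in [phi f * A_phi] for all [f]; then [psi] is determined by
    [psi w = phi w * c] with [c] in [A_phi].  Every such [c] occurs: by a lemma
    of Brauer, [(phi w * c) ^ n] is conjugate to [phi w ^ n] under [A_phi], which
    centralises [phi (w ^ n)], so the two powers are equal.  The stabiliser of
    the similarity class of [phi] under conjugation by [A] is [A_phi], so the
    union of the [A]-translates of this class has [|A : A_phi| * |A_phi| = |A|]
    elements.  Finally [Phi] is a union of such sets: if [psi] is similar to
    [phi], Brauer's lemma modulo [H_{phi,k}] gives [t] in [H_phi] for which the
    conjugate of [psi] by [t^-1] agrees with [phi] modulo [H_{phi,k}] on [w ^ k],
    hence on all degrees that are multiples of [k]. *)

Set Implicit Arguments.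
Unset Strict Implicit.
Unset Printing Implicit Defensive.
Import GRing.Theory.

Local Open Scope card_scope.
Local Open Scope group_scope.
Local Open Scope classical_set_scope.

(** * Divisibility of cardinals, classes and orbits *)

Lemma dvd_card_trans {T U V : Type} (A : set T) (B : set U) (C : set V) :
  dvd_card A B -> dvd_card B C -> dvd_card A C.
Proof.
move=> AB [C0|[b [c [Bb Cc bc]]]|[iC B0 BC]]; first exact: Or31.
- case: AB => [B0|[a [b' [Aa Bb' ab]]]|[iB _ _]]; last by case: iB; exists b.
    apply: Or31.
    have b0 : b = 0%N.
      apply/card_eq_II; rewrite card_eq_sym in Bb; apply: card_eq_trans Bb _.
      by rewrite B0 II0; exact: card_eq00.
    by move: bc Cc; rewrite b0 dvd0n => /eqP ->; rewrite II0 card_eq0 => /eqP.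
  have bb' : b' = b.
    by apply/card_eq_II; rewrite card_eq_sym in Bb'; exact: card_eq_trans Bb' Bb.
  by apply: Or32; exists a, c; split=> //; apply: dvdn_trans bc; rewrite -bb'.
- case: AB => [BE|[a [b [Aa Bb ab]]]|[iB A0 AB]]; first by rewrite BE in B0; case: B0.
  + have b_gt0 : (0 < b)%N.
      rewrite lt0n; apply/eqP => b0; case: B0 => x.
      by move: Bb; rewrite b0 II0 card_eq0 => /eqP ->.
    have a_gt0 := dvdn_gt0 b_gt0 ab.
    apply: Or33; split=> //.
      apply/set0P/negP => /eqP A0; move: Aa; rewrite A0 card_eq_sym card_eq0.
      by move/eqP/seteqP => [/(_ 0%N a_gt0)].
    rewrite (card_le_eql Aa); apply: card_le_trans BC.
    by rewrite (card_le_eqr Bb) card_le_II dvdn_leq.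
  + by apply: Or33; split=> //; exact: card_le_trans BC.
Qed.

(** [C] gives each point its class in a partition of [B]. A finite [B] is numbered and counted as a
    uniform partition; an infinite one contains a copy of [A], namely any class, and [A] is nonempty
    because classes are. *)
Lemma dvd_card_classes {T U : Type} (A : set U) (B : set T) (C : T -> set T) :
  (forall x, B x -> C x x) ->
  (forall x y, B x -> C x y -> B y /\ C y = C x) ->
  (forall x, B x -> C x #= A) ->
  dvd_card A B.
Proof.
move=> Cxx Cxy CA.
have CB x : B x -> C x `<=` B by move=> Bx y /(Cxy _ _ Bx) [].
have [B0|] := eqVneq B set0; first exact: Or31.
  move=> /set0P [x0 Bx0]; have [[b Bb]|iB] := pselect (finite_set B); last first.
    apply: Or33; split=> //.
      apply/set0P/negP => /eqP A0; have := CA _ Bx0; rewrite A0 card_eq0.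
      by move=> /eqP C0; have := Cxx _ Bx0; rewrite C0.
    by rewrite -(card_le_eql (CA _ Bx0)); exact: subset_card_le (CB _ Bx0).
have [a Ca] : finite_set (C x0) by apply: sub_finite_set (CB _ Bx0) _; exists b.
have Aa : A #= `I_a by apply: card_eq_trans Ca; rewrite card_eq_sym; exact: CA.
apply: Or32; exists a, b; split=> //.
have [g [gB ginj gsurj]] : exists g, set_bij `I_b B g.
  have [f fB] := card_set_bijP Bb.
  by exists ('pinv_(fun=> x0) B f); exact: bijpinv_bij.
have gBi (i : 'I_b) : B (g i) by apply: gB => /=.
have gI (i j : 'I_b) : g i = g j -> i = j.
  by move=> ij; apply: val_inj; apply: ginj ij; rewrite inE /=.
pose R (i j : 'I_b) := `[< C (g i) (g j) >].
have eR : {in [set: 'I_b]%SET & &, equivalence_rel R}.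
  move=> i j l _ _ _; split; first by apply/asboolP/Cxx.
  by move=> /asboolP Cij; rewrite /R; have [_ ->] := Cxy _ _ (gBi i) Cij.
have Pp := equivalence_partitionP eR.
suff Pu : {in equivalence_partition R [set: 'I_b]%SET,
           forall X : {set 'I_b}, #|X| = a}.
  by have := card_uniform_partition Pu Pp; rewrite cardsT card_ord => ->; exact: dvdn_mull.
move=> X /imsetP[i _ ->]; set X0 := [set _ in _ | _]%SET.
have Xa : C (g i) #= `I_a by apply: card_eq_trans Aa; exact: CA.
have CX : C (g i) = (fun j : 'I_b => g j) @` [set` enum X0].
  apply/seteqP; split=> [y Cy|_ [j /= + <-]]; last first.
    by rewrite mem_enum finset.in_set finset.in_setT => /asboolP.
  have [j jb jy] := gsurj y (CB _ (gBi i) _ Cy).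
  exists (Ordinal jb) => //=.
  by rewrite mem_enum finset.in_set finset.in_setT; apply/asboolP; rewrite /= jy.
have XX : [set` enum X0] #= `I_#|X0|.
  by have := card_eq_undup (enum X0); rewrite undup_id ?enum_uniq // -cardE.
apply/card_eq_II; rewrite card_eq_sym in XX; apply: card_eq_trans XX _.
apply: card_eq_trans Xa; rewrite CX card_eq_sym.
by apply: inj_card_eq => j l _ _; exact: gI.
Qed.

(** The orbits of [R] serve as the classes; the exact period [d] makes each consist of [d] distinct
    iterates. *)
Lemma dvd_card_orbits {T : Type} (B : set T) (R : T -> T) (d : nat) :
  (0 < d)%N ->
  (forall x, B x -> B (R x)) ->
  (forall x, B x -> iter d R x = x) ->
  (forall x i, B x -> (0 < i < d)%N -> iter i R x <> x) ->
  dvd_card `I_d B.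
Proof.
move=> d0 BR Rd Ri.
have BRi x i : B x -> B (iter i R x) by move=> Bx; elim: i => //= i; exact: BR.
have Rdq x q : B x -> iter (q * d) R x = x.
  by move=> Bx; elim: q => // q IH; rewrite mulSn iterD IH Rd.
pose C x := [set iter i R x | i in [set: nat]].
apply: (@dvd_card_classes _ _ _ _ C) => [x _|x _ Bx [i _ <-]|x Bx].
- by exists 0%N.
- split; first exact: BRi.
  apply/seteqP; split=> _ [j _ <-]; first by rewrite -iterD; exists (j + i)%N.
  (* After [i] steps, [i * d - i] more complete [i] full periods and return to [x]. *)
  exists (j + (i * d - i))%N => //.
  by rewrite iterD -[in X in iter j R X](iterD (i * d - i)) subnK ?Rdq // leq_pmulr.
have -> : C x = [set iter i R x | i in `I_d].
  apply/seteqP; split=> _ [i _ <-]; last by exists i.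
  exists (i %% d)%N; first by rewrite /= ltn_mod.
  by rewrite {2}(divn_eq i d) addnC iterD Rdq.
apply: inj_card_eq.
suff lt i j : (i < j < d)%N -> iter i R x <> iter j R x.
  move=> i j; rewrite !inE /= => id jd ij.
  by case: (ltngtP i j) => // h; [case: (lt i j)|case: (lt j i)] => //; apply/andP.
move=> /andP[ij jd] e; have id := ltn_trans ij jd.
(* Modulo the period, [j - i] steps are [j] steps followed by [d - i]; by [e] these equal [i] steps
   followed by [d - i], hence a full period. *)
case: (Ri x (j - i)%N Bx).
  by rewrite subn_gt0 ij (leq_ltn_trans (leq_subr _ _)).
rewrite -{1}(Rd x Bx) -iterD addnC addnBA 1?ltnW // -addnBAC 1?ltnW //.
by rewrite iterD -e -iterD subnK 1?ltnW // Rd.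
Qed.

(** * Normalisers, cosets and Brauer's lemma *)

Section Groups.
Variable G : groupType.
Implicit Types (H K U C X : set G) (a b g u v x y : G).

(** An equivalence is required because, for infinite [K], mapping [K] into itself by conjugation is
    not stable under inverses. *)
Definition normaliser K : set G := [set g | forall x, K (x ^ g) <-> K x].

Lemma subgroup_normaliser K : subgroup (normaliser K).
Proof.
split=> [x|x y nx ny z|x nx z]; first by rewrite conjg1.
  by rewrite conjgM (ny (z ^ x)).
by rewrite -(nx (z ^ x^-1)) conjgKV.
Qed.

Lemma subgroupX K x i : subgroup K -> K x -> K (x ^+ i).
Proof.
by move=> [K1 KM _] Kx; elim: i => [|i IH]; rewrite ?expg0 ?expgSr //; exact: KM.
Qed.

Lemma subgroup_normalises K x : subgroup K -> K x -> normaliser K x.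
Proof.
move=> [_ KM KV] Kx z; rewrite conjgE; split=> Kz.
  have -> : z = x * (x^-1 * (z * x)) * x^-1 by rewrite mulVKg mulgK.
  by apply: (KM _ _ _ (KV _ Kx)); exact: KM.
by apply: (KM _ _ (KV _ Kx)); exact: KM.
Qed.

Lemma conjset_normaliser K g : conjset K g = K -> normaliser K g.
Proof.
move=> e x; split=> [|Kx]; rewrite -{1}e; last by exists x.
by move=> [y Ky /conjg_inj <-].
Qed.

Lemma conjsetE K g x : conjset K g x <-> K (x ^ g^-1).
Proof.
by split=> [[y Ky <-]|Kx]; [rewrite conjgK | exists (x ^ g^-1); rewrite ?conjgKV].
Qed.

Lemma lcosetE K g x : lcoset g K x <-> K (g^-1 * x).
Proof.
by split=> [[y Ky <-]|Kx]; [rewrite mulKg | exists (g^-1 * x); rewrite ?mulVKg].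
Qed.

Lemma lcoset_set1 a : lcoset a [set 1] = [set a].
Proof.
by apply/seteqP; split=> [_ [_ -> <-]|_ ->]; [rewrite mulg1 | exists 1; rewrite ?mulg1].
Qed.

Lemma lcosetM K a b : lcoset a (lcoset b K) = lcoset (a * b) K.
Proof. by apply/seteqP; split=> x; rewrite !lcosetE invgM mulgA. Qed.

Lemma eq_lcoset K a b : subgroup K -> (lcoset a K = lcoset b K) <-> K (a^-1 * b).
Proof.
move=> [K1 KM KV]; rewrite -lcosetE; split=> [->|/lcosetE Kab].
  by apply/lcosetE; rewrite mulVg.
apply/seteqP; split=> x /lcosetE Kx; apply/lcosetE.
  have -> : b^-1 * x = (a^-1 * b)^-1 * (a^-1 * x).
    by rewrite invgM invgK -mulgA mulVKg.
  by apply: KM => //; exact: KV.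
have -> : a^-1 * x = (a^-1 * b) * (b^-1 * x) by rewrite -mulgA mulVKg.
exact: KM.
Qed.

Lemma rcoset_normaliser K a g : normaliser K g ->
  [set y * g | y in lcoset a K] = lcoset (a * g) K.
Proof.
move=> nK; apply/seteqP; split=> [_ [_ [y Ky <-] <-]|_ [y Ky <-]].
  by apply/lcosetE; rewrite invgM -!mulgA mulKg -conjgE; apply/nK.
exists (a * (y ^ g^-1)); last by rewrite -[LHS]mulgA -conjgCV mulgA.
by exists (y ^ g^-1) => //; rewrite -nK conjgKV.
Qed.

Lemma lcosetX K g x i : subgroup K -> normaliser K g -> lcoset g K x ->
  lcoset (g ^+ i) K (x ^+ i).
Proof.
move=> sK nK /lcosetE Kx; have [K1 KM KV] := sK; apply/lcosetE; elim: i => [|i IH].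
  by rewrite !expg0 mulVg.
have -> : (g ^+ i.+1)^-1 * x ^+ i.+1 = ((g ^+ i)^-1 * x ^+ i) ^ g * (g^-1 * x).
  by rewrite !expgSr conjgE invgM -!mulgA mulVKg.
by apply: KM => //; apply/nK.
Qed.

(** Left translation by [C] partitions the cosets of [K] in [U] into orbits. Right multiplication by
    [a0^-1 * a] maps cosets to cosets, since [U] normalises [K], and carries the orbit of [a0 K]
    bijectively onto that of [a K]. *)
Lemma dvd_card_translates K C U a0 :
  subgroup K -> subgroup C -> subgroup U -> C `<=` U -> U `<=` normaliser K ->
  U a0 -> dvd_card [set lcoset c (lcoset a0 K) | c in C] (quotient_set U K).
Proof.
move=> sK [C1 CM CV] [U1 UM UV] CU nK Ua0.
pose cl X := [set lcoset c X | c in C].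
apply: (@dvd_card_classes _ _ _ _ cl) => [_ [a Ua <-]|_ _ [a Ua <-] [c Cc <-]|_ [a Ua <-]].
- by exists 1 => //; rewrite lcosetM mul1g.
- split; first by exists (c * a); rewrite ?lcosetM //; apply: UM => //; exact: CU.
  apply/seteqP; split=> _ [c' Cc' <-]; rewrite !lcosetM.
    by exists (c' * c); rewrite ?lcosetM ?mulgA //; exact: CM.
  by exists (c' * c^-1); rewrite ?lcosetM ?mulgA ?mulgVK //; apply: CM => //; exact: CV.
pose f (X : set G) := [set y * (a0^-1 * a) | y in X].
have nf : normaliser K (a0^-1 * a) by apply/nK/UM => //; exact: UV.
rewrite card_eq_sym.
have -> : cl (lcoset a K) = f @` cl (lcoset a0 K).
  apply/seteqP; split=> [_ [c Cc <-]|_ [_ [c Cc <-] <-]].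
    exists (lcoset c (lcoset a0 K)); first by exists c.
    by rewrite /f !lcosetM rcoset_normaliser // -!mulgA mulVKg.
  exists c => //.
  by rewrite /f !lcosetM rcoset_normaliser // -!mulgA mulVKg.
rewrite card_eq_sym; apply: inj_card_eq => X Y _ _ /seteqP[XY YX].
apply/seteqP; split=> x Xx.
  by have [|y Yy /(congr1 (fun z => z * (a0^-1 * a)^-1))] := XY (x * (a0^-1 * a));
    [exists x | rewrite !mulgK => <-].
by have [|y Yy /(congr1 (fun z => z * (a0^-1 * a)^-1))] := YX (x * (a0^-1 * a));
  [exists x | rewrite !mulgK => <-].
Qed.

(** Brauer's lemma relative to [K].  The map [X |-> v^-1 X (v u)] permutes the
    left cosets of [K] in [U].  The points fixed by its [d]-th power, [d] the
    least period that occurs, split into orbits of length exactly [d] and form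
    one translate of the cosets of a subgroup; hence [d] divides [|U / K|]. *)
Lemma expg_coset_conj K U v u k :
  subgroup K -> subgroup U -> K `<=` U ->
  normaliser K v -> normaliser U v -> U `<=` normaliser K ->
  dvd_card (quotient_set U K) `I_k -> U u ->
  exists2 t, U t & lcoset ((v ^+ k) ^ t) K ((v * u) ^+ k).
Proof.
move=> sK sU KU nKv nUv nKU dk Uu; have [K1 KM KV] := sK; have [U1 UM UV] := sU.
have [-> | k0] := posnP k.
  by exists 1 => //; rewrite !expg0 conj1g; apply/lcosetE; rewrite invg1 mulg1.
have [NK1 NKM NKV] := subgroup_normaliser K.
set x := v * u; pose R X := [set v^-1 * y * x | y in X].
have nKx : normaliser K x by apply: NKM => //; exact: nKU.
have Rl a : R (lcoset a K) = lcoset (v^-1 * a * x) K.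
  rewrite -rcoset_normaliser // -lcosetM.
  apply/seteqP; split=> [_ [y Ky <-]|_ [_ [y Ky <-] <-]]; last by exists y.
  by exists (v^-1 * y) => //; exists y.
pose r i a := (v ^+ i)^-1 * a * x ^+ i.
have Ri i a : iter i R (lcoset a K) = lcoset (r i a) K.
  elim: i => [|i IH] /=; first by rewrite /r !expg0 invg1 mul1g mulg1.
  by rewrite IH Rl /r !expgSr invgM !mulgA.
have Ur i a : U a -> U (r i a).
  move=> Ua; elim: i => [|i IH]; first by rewrite /r !expg0 invg1 mul1g mulg1.
  have -> : r i.+1 a = (r i a) ^ v * u by rewrite /r conjgE !expgSr invgM !mulgA.
  by apply: UM => //; apply/nUv.
pose per d := (0 < d)%N && `[< exists2 a, U a & iter d R (lcoset a K) = lcoset a K >].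
have fUK : finite_set (quotient_set U K).
  case: dk => [/seteqP[/(_ 0%N k0)]//|[m [_ [UKm _ _]]]|[[]]]; first by exists m.
  by exists k.
have /ex_minnP[d /andP[d0 /asboolP[a0 Ua0 pa0]] dmin] : exists d, per d.
  (* Pigeonhole: the iterates of the coset of [1] stay in a finite set, so two coincide, and the
     difference of their indices is a period. *)
  have [inj|] := pselect (injective (fun i => lcoset (r i 1) K)).
    case: infinite_nat; move: fUK; rewrite finite_setPn => nUK.
    apply/finite_setPn => nn; apply: nUK.
    have : (fun i => lcoset (r i 1) K) @` [set: nat] #= [set: nat].
      by apply: inj_card_eq => i j _ _; exact: inj.
    rewrite card_eq_sym => /card_le_eql => ->.
    by apply: subset_card_le => _ [i _ <-]; exists (r i 1) => //; exact: Ur.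
  move=> /existsNP[i] /existsNP[j] /not_implyP[].
  wlog ij : i j / (i < j)%N => [W e ne|e _].
    case: (ltngtP i j) => [ij|ij|//]; first exact: W ij e ne.
    exact: W ij (esym e) (nesym ne).
  exists (j - i)%N; rewrite /per subn_gt0 ij; apply/asboolP.
  by exists (r i 1); [exact: Ur | rewrite -{1}Ri -iterD subnK ?Ri // ltnW].
pose B := [set X | quotient_set U K X /\ iter d R X = X].
have dB : dvd_card `I_d B.
  apply: (dvd_card_orbits (R := R)) => //.
  - move=> _ [[a Ua <-] pa]; split; last by rewrite -iterSr iterS pa.
    by exists (v^-1 * a * x); rewrite ?Rl //; exact: (Ur 1%N a Ua).
  - by move=> X [].
  - move=> _ i [[a Ua <-] _] /andP[i0 id] pa.
    suff /dmin : per i by rewrite leqNgt id.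
    by rewrite /per i0; apply/asboolP; exists a.
(* The centraliser of [v ^+ d] in [U] modulo [K]: left translation by [c] keeps the coset of [a0]
   fixed by the [d]-th power of [R] exactly when [c] lies in it. *)
pose C := [set c | U c /\ K (c^-1 * c ^ (v ^+ d))].
have nKw : normaliser K (v ^+ d) by exact: (@subgroupX (normaliser K) v d (subgroup_normaliser K) nKv).
have sC : subgroup C.
  split=> [|a b [Ua Ka] [Ub Kb]|a [Ua Ka]].
  - by split=> //; rewrite conj1g mulg1 invg1.
  - split; first exact: UM.
    have -> : (a * b)^-1 * (a * b) ^ (v ^+ d) =
              (a^-1 * a ^ (v ^+ d)) ^ b * (b^-1 * b ^ (v ^+ d)).
      rewrite conjMg; move: (a ^ _) (b ^ _) => aw bw.
      by rewrite conjgE invgM -!mulgA mulVKg.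
    by apply: KM => //; apply/nKU.
  - split; first exact: UV.
    have -> : a^-1^-1 * a^-1 ^ (v ^+ d) = (a^-1 * a ^ (v ^+ d))^-1 ^ a^-1.
      rewrite [in LHS]conjVg; move: (a ^ _) => aw.
      by rewrite conjgE invgM !invgK -!mulgA mulgV mulg1.
    by apply/nKU; [exact: UV | exact: KV].
have BC : B = [set lcoset c (lcoset a0 K) | c in C].
  have Ka0 : K (a0^-1 * r d a0) by apply/eq_lcoset; rewrite // -Ri.
  have key c : (c * a0)^-1 * r d (c * a0) =
      (c^-1 * c ^ (v ^+ d)) ^ a0 * (a0^-1 * r d a0).
    by rewrite /r !conjgE !invgM -!mulgA !(mulVKg, mulKg).
  have CP c : U c -> (K (c^-1 * c ^ (v ^+ d)) <-> K ((c * a0)^-1 * r d (c * a0))).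
    move=> Uc; rewrite key -(nKU _ Ua0 (c^-1 * _)).
    split=> [Kc|Kc]; first exact: KM.
    by have := KM _ _ Kc (KV _ Ka0); rewrite mulgK.
  apply/seteqP; split=> [_ [[a Ua <-] pa]|_ [c [Uc Kc] <-]].
    have Uc : U (a * a0^-1) by apply: UM => //; exact: UV.
    exists (a * a0^-1); last by rewrite lcosetM mulgVK.
    by split=> //; apply/CP; rewrite // mulgVK; apply/eq_lcoset; rewrite -?Ri.
  rewrite lcosetM; split; first by exists (c * a0) => //; exact: UM.
  by rewrite Ri; apply/esym/eq_lcoset => //; apply/CP.
have {}dk : (d %| k)%N.
  apply: (@dvd_card_II _ _ `I_d `I_k) => //; do ?exact: card_eqxx.
  apply: dvd_card_trans dB _; apply: dvd_card_trans dk; rewrite BC.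
  by apply: dvd_card_translates => // c [].
(* That the coset of [a0] is fixed means that [x ^+ d] lies in [(v ^+ d) ^ a0 * K]; it remains to
   raise this to the power [k %/ d]. *)
exists a0 => //; rewrite -(divnK dk) mulnC !expgnA conjXg.
have nKa0 := nKU _ Ua0.
apply: lcosetX => //.
  by apply: (NKM _ _ (NKV _ nKa0)); exact: (NKM _ _ nKw nKa0).
by apply/lcosetE; rewrite conjgE !invgM !invgK -!mulgA; move/esym: pa0; rewrite Ri => /eq_lcoset; rewrite /r -!mulgA; exact.
Qed.

End Groups.

(** * The degree group and integer powers *)

Lemma Zmod_cyclic (n : int) : exists2 e : Zmod n,
  (forall z, exists j : int, z = (e *~ j)%R) &
  forall j, (e *~ j = 0)%R <-> (n %| j)%Z.
Proof.
rewrite /Zmod; set Q := Quotient.quot _.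
have pij (j : int) : ((\pi_Q 1)%qT *~ j)%R = (\pi_Q j)%qT by rewrite -raddfMz intz.
exists (\pi_Q 1%R)%qT => [z|j]; first by exists (repr z); rewrite pij reprK.
have -> : ((n %| j)%Z : Prop) = ((\pi_Q j)%qT == 0%R :> Q).
  by rewrite -(@raddf0 _ _ (\pi_Q)%qT) -Quotient.idealrBE subr0.
by rewrite pij; split=> /eqP.
Qed.

Section IntegerPowers.
Variable G : groupType.
Implicit Types (g h x : G) (i j : int).

(** Degrees are integer multiples of a generator, and for [n = 0] negative multiples cannot be
    avoided. [Negz m] is the integer [-(m + 1)]. *)
Definition zpow g j : G :=
  match j with Posz m => g ^+ m | Negz m => g ^- m.+1 end.

Lemma zpowS g j : zpow g (j + 1)%R = zpow g j * g.
Proof.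
case: j => [m|[|m]] /=; first by rewrite addn1 expgSr.
  by rewrite expg0 expg1 mulVg.
by rewrite subn1 /= [in RHS]expgS invgM mulgVK.
Qed.

Lemma zpowD g i j : zpow g (i + j)%R = zpow g i * zpow g j.
Proof.
elim/int_ind: j => [|m IH|m IH]; first by rewrite addr0 mulg1.
  by rewrite intS [(1 + _)%R]addrC addrA !zpowS IH mulgA.
apply: (@mulIg _ g); rewrite -zpowS -mulgA -zpowS.
by rewrite intS opprD [(-1 + _)%R]addrC addrA !subrK.
Qed.

Lemma zpowN g j : zpow g (- j)%R = (zpow g j)^-1.
Proof. by apply/esym/mulg1_eq; rewrite -zpowD subrr. Qed.

Lemma zpowM g i j : zpow g (i * j)%R = zpow (zpow g i) j.
Proof.
elim/int_ind: j => [|m IH|m IH]; first by rewrite mulr0.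
  by rewrite intS [(1 + _)%R]addrC mulrDr mulr1 zpowD zpowS IH.
apply: (@mulIg _ (zpow g i)); rewrite -zpowS -zpowD.
by rewrite intS opprD [(-1 + _)%R]addrC subrK -IH mulrDr mulrN1 subrK.
Qed.

Lemma subgroup_zpow (K : set G) x j : subgroup K -> K x -> K (zpow x j).
Proof.
by move=> sK Kx; have [_ _ KV] := sK; case: j => m /=; [|apply: KV]; exact: subgroupX.
Qed.

End IntegerPowers.

(** * Homomorphisms from an indexed group and their cores *)

Section Indexed.
Variables (n : int) (F G : groupType) (deg : F -> Zmod n).
Hypothesis degM : {morph deg : x y / x * y >-> (x + y)%R}.
Implicit Types (phi psi chi : {multiplicative F -> G}) (A H K : set G) (f w : F).

Lemma hom_eq phi psi : phi =1 psi -> phi = psi.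
Proof.
case: phi psi => [f [[fM]]] [g [[gM]]] /= /funext fg; subst g.
by rewrite (Prop_irrelevance fM gM).
Qed.

Definition conjh phi (h : G) : {multiplicative F -> G} := conj_hom phi h.

Lemma conjhM phi g h : conjh (conjh phi g) h = conjh phi (g * h).
Proof. by apply: hom_eq => f; rewrite /= /conj_hom conjgM. Qed.

Lemma conjh1 phi : conjh phi 1 = phi.
Proof. by apply: hom_eq => f; rewrite /= /conj_hom conjg1. Qed.

Lemma conjhK phi g : conjh (conjh phi g^-1) g = phi.
Proof. by rewrite conjhM mulVg conjh1. Qed.

Lemma hom1 phi : phi 1 = 1.
Proof. by apply: (@mulgI _ (phi 1)); rewrite -gmulfM !mulg1. Qed.

Lemma homV phi f : phi f^-1 = (phi f)^-1.
Proof. by apply/esym/mulg1_eq; rewrite -gmulfM mulgV hom1. Qed.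

Lemma homX phi f i : phi (f ^+ i) = phi f ^+ i.
Proof. by elim: i => [|i IH]; rewrite ?expg0 ?hom1 // !expgS gmulfM IH. Qed.

Lemma homJ phi f g : phi (f ^ g) = phi f ^ phi g.
Proof. by rewrite !conjgE !gmulfM homV. Qed.

Lemma hom_zpow phi f j : phi (zpow f j) = zpow (phi f) j.
Proof. by case: j => m /=; rewrite ?homV homX. Qed.

Lemma deg1 : deg 1 = 0%R.
Proof. by apply: (@addrI _ (deg 1)); rewrite -degM mulg1 addr0. Qed.

Lemma degV f : deg f^-1 = (- deg f)%R.
Proof. by apply: (@addrI _ (deg f)); rewrite -degM mulgV subrr deg1. Qed.

Lemma degX f i : deg (f ^+ i) = (deg f *+ i)%R.
Proof. by elim: i => [|i IH]; rewrite ?expg0 ?deg1 // expgS degM IH mulrS. Qed.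

Lemma deg_zpow f j : deg (zpow f j) = (deg f *~ j)%R.
Proof. by case: j => m; rewrite /= ?degV degX. Qed.

Lemma degJ f g : deg (f ^ g) = deg f.
Proof. by rewrite conjgE !degM degV [(deg f + _)%R]addrC addKr. Qed.

(** Dividing [f] by a power of [w ^+ k] of the same degree leaves an element of degree zero. *)
Lemma degree_multiple_subgroup (S : set F) w k f :
  (forall z, exists j : int, z = (deg w *~ j)%R) ->
  subgroup S -> (forall f, deg f = 0%R -> S f) -> S (w ^+ k) ->
  (exists z : Zmod n, deg f = (z *+ k)%R) -> S f.
Proof.
move=> w_gen sS S0 Sw [z fz]; have [j zj] := w_gen z; have [_ SM _] := sS.
rewrite -(mulVKg (zpow (w ^+ k) j) f).
apply: SM; first exact: subgroup_zpow.
apply: S0; rewrite degM degV deg_zpow degX fz zj.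
by rewrite !pmulrn -!mulrzA mulrC addNr.
Qed.

Lemma degree_subgroup (S : set F) w :
  (forall z, exists j : int, z = (deg w *~ j)%R) ->
  subgroup S -> (forall f, deg f = 0%R -> S f) -> S w -> forall f, S f.
Proof.
move=> w_gen sS S0 Sw f.
apply: (degree_multiple_subgroup (k := 1) w_gen sS S0); first by rewrite expg1.
by exists (deg f); rewrite mulr1n.
Qed.

(** Because of this, congruence of two homomorphisms modulo [K] need only be checked on
    generators. *)
Lemma subgroup_hom_lcoset phi psi K :
  subgroup K -> (forall f, normaliser K (phi f)) ->
  subgroup [set f | lcoset (phi f) K (psi f)].
Proof.
move=> [K1 KM KV] nK; split=> [|f g|f] /=; rewrite ?lcosetE.
- by rewrite !hom1 invg1 mulg1.
- move=> Kf Kg; have -> : (phi (f * g))^-1 * psi (f * g) =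
      ((phi f)^-1 * psi f) ^ phi g * ((phi g)^-1 * psi g).
    by rewrite !gmulfM invgM conjgE -!mulgA mulVKg.
  by apply: KM => //; apply/nK.
- move=> Kf; have -> : (phi f^-1)^-1 * psi f^-1 = ((phi f)^-1 * psi f)^-1 ^ phi f^-1.
    by rewrite !homV conjgE invgM !invgK -!mulgA mulgV mulg1.
  by apply/nK/KV.
Qed.

Lemma phi_coreE phi H h : phi_core deg phi H h <->
  (forall f, H (h ^ phi f)) /\ (forall f, deg f = 0%R -> commute h (phi f)).
Proof.
split=> [[Hh Ch]|[Hh Ch]]; split=> f.
- by have /conjsetE := Hh f^-1 I; rewrite homV invgK.
- by move=> f0; apply: Ch; exists f.
- by move=> _; apply/conjsetE; rewrite -homV.
- by move=> [g g0 <-]; exact: Ch.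
Qed.

Lemma phi_core_sub phi H : phi_core deg phi H `<=` H.
Proof. by move=> h /phi_coreE[/(_ 1)]; rewrite hom1 conjg1. Qed.

Lemma phi_coreS phi A H : A `<=` H -> phi_core deg phi A `<=` phi_core deg phi H.
Proof.
by move=> AH h /phi_coreE[Ah Ch]; apply/phi_coreE; split=> // f; exact: AH.
Qed.

(** Conjugation in [F] preserves the kernel of [deg], so conjugation by [phi f] preserves the
    centraliser of its image. *)
Lemma phi_core_hom phi H h f : phi_core deg phi H h -> phi_core deg phi H (h ^ phi f).
Proof.
move=> /phi_coreE[Hh Ch]; apply/phi_coreE; split=> g.
  by rewrite -conjgM -gmulfM.
move=> g0; have /Ch : deg (g ^ f^-1) = 0%R by rewrite degJ.
move=> /(congr1 (fun x => x ^ phi f)).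
by rewrite !conjMg -!homJ conjgKV.
Qed.

Lemma phi_core_normal phi H f : normaliser (phi_core deg phi H) (phi f).
Proof.
move=> h; split=> [|Hh]; last exact: phi_core_hom.
by move/(phi_core_hom f^-1); rewrite homV conjgK.
Qed.

Lemma subgroup_phi_core phi H : subgroup H -> subgroup (phi_core deg phi H).
Proof.
move=> [H1 HM HV]; split=> [|x y|x]; rewrite !phi_coreE.
- by split=> f; [rewrite conj1g | move=> _; exact/commute_sym/commute1].
- move=> [Hx Cx] [Hy Cy]; split=> f; first by rewrite conjMg; exact: HM.
  by move=> f0; apply/commute_sym/commuteM; apply/commute_sym; auto.
- move=> [Hx Cx]; split=> f; first by rewrite conjVg; exact: HV.
  by move=> f0; apply/commute_sym/commuteV/commute_sym/Cx.
Qed.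

Lemma phi_core_conj phi A h x :
  subgroup A -> A h -> phi_core deg (conjh phi h) A (x ^ h) <-> phi_core deg phi A x.
Proof.
move=> sA Ah; have nAh := subgroup_normalises sA Ah; rewrite !phi_coreE.
have cJ f : commute (x ^ h) (phi f ^ h) <-> commute x (phi f).
  by rewrite /commute -!conjMg; split=> [/conjg_inj|->].
split=> -[Hx Cx]; split=> f.
- by rewrite -nAh conjJg; exact: Hx.
- by move=> f0; apply/cJ; exact: Cx.
- by rewrite /= /conj_hom -conjJg; apply/nAh.
- by move=> f0; apply/cJ; exact: Cx.
Qed.

(** * Similarity of homomorphisms *)

Definition similar A phi psi : Prop :=
  (forall f, deg f = 0%R -> psi f = phi f) /\
  (forall f, lcoset (phi f) (phi_core deg phi A) (psi f)).

Section Similar.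
Variable A : set G.
Hypothesis sA : subgroup A.

(** Conjugation by [psi f = phi f * c] is conjugation by [phi f] followed by conjugation by an
    element of the core of [phi]; both preserve that core. *)
Lemma similar_core_sub phi psi : similar A phi psi ->
  phi_core deg phi A `<=` phi_core deg psi A.
Proof.
move=> [psi0 psiA] h hA; have [_ CM CV] := subgroup_phi_core phi sA.
apply/phi_coreE; split=> f; last first.
  by move=> f0; rewrite psi0 //; move/phi_coreE: hA => [_]; exact.
have [c Ac <-] := psiA f; rewrite conjgM.
apply: (@phi_core_sub phi).
by apply/(subgroup_normalises (subgroup_phi_core phi sA) Ac); exact: phi_core_hom.
Qed.

Lemma similar_sym phi psi : similar A phi psi -> similar A psi phi.
Proof.
move=> s; have [psi0 psiA] := s; split=> f; first by move=> f0; rewrite psi0.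
have [_ _ CV] := subgroup_phi_core phi sA.
apply/lcosetE/(similar_core_sub s).
by have /lcosetE/CV := psiA f; rewrite invgM invgK.
Qed.

Lemma similar_core phi psi : similar A phi psi ->
  phi_core deg phi A = phi_core deg psi A.
Proof.
move=> s; apply/seteqP; split; first exact: similar_core_sub.
exact/similar_core_sub/similar_sym.
Qed.

Lemma similar_trans psi phi chi :
  similar A phi psi -> similar A psi chi -> similar A phi chi.
Proof.
move=> s [chi0 chiA]; have [psi0 psiA] := s; split=> f.
  by move=> f0; rewrite chi0 ?psi0.
have [_ CM _] := subgroup_phi_core phi sA.
have /lcosetE a := psiA f; have := chiA f.
rewrite -(similar_core s) !lcosetE => b.
by have := CM _ _ a b; rewrite -mulgA mulVKg.
Qed.

Lemma similar_refl phi : similar A phi phi.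
Proof.
have [C1 _ _] := subgroup_phi_core phi sA.
by split=> // f; apply/lcosetE; rewrite mulVg.
Qed.

Lemma similar_conj phi psi h : A h -> similar A phi psi ->
  similar A (conjh phi h) (conjh psi h).
Proof.
move=> Ah [psi0 psiA]; split=> f.
  by move=> f0; rewrite /= /conj_hom psi0.
apply/lcosetE; rewrite /= /conj_hom -conjVg -conjMg.
by apply/phi_core_conj => //; apply/lcosetE.
Qed.

(** This computes the stabiliser of a similarity class in [A]. Identity [E] turns the coset
    condition into membership of [h ^ phi f] in [A], and agreement on the kernel means that [h]
    centralises its image. *)
Lemma similar_conj_core phi h : A h ->
  similar A phi (conjh phi h) <-> phi_core deg phi A h.
Proof.
move=> Ah; have [C1 CM CV] := subgroup_phi_core phi sA; have [A1 AM AV] := sA.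
have E f : (phi f)^-1 * (phi f ^ h) = (h ^ phi f)^-1 * h.
  by rewrite !conjgE !invgM !invgK -!mulgA.
split=> [[s0 sC]|Ch].
  apply/phi_coreE; split=> f; last first.
    move=> /s0 /(congr1 (fun x => h * x)).
    by rewrite /= /conj_hom conjgE mulVKg /commute => <-.
  have /lcosetE := sC f; rewrite /= /conj_hom E => /phi_core_sub e.
  have -> : h ^ phi f = h * ((h ^ phi f)^-1 * h)^-1.
    by rewrite invgM invgK mulVKg.
  by apply: AM => //; exact: AV.
split=> f.
  move=> f0; rewrite /= /conj_hom conjgE.
  have /phi_coreE[_ /(_ f f0)] := Ch.
  by rewrite /commute => <-; rewrite mulKg.
apply/lcosetE; rewrite /= /conj_hom E.
by apply: CM => //; apply: CV; exact: phi_core_hom.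
Qed.

End Similar.

(** Keeping [phi] on the kernel and sending [w] to [x = phi w * c] is consistent once [x] acts on
    the image of the kernel as [phi w] does and [x] has the same [n]-th power as [phi w]. *)
Lemma similar_exists A phi w c :
  (forall z, exists j : int, z = (deg w *~ j)%R) ->
  (forall j, (deg w *~ j = 0)%R <-> (n %| j)%Z) ->
  subgroup A -> dvd_card A `I_(absz n) ->
  phi_core deg phi A c ->
  exists2 psi, similar A phi psi & psi w = phi w * c.
Proof.
move=> w_gen w_ord sA An Cc.
set C := phi_core deg phi A in Cc; have sC : subgroup C by exact: subgroup_phi_core.
have [C1 CM CV] := sC.
set x := phi w * c.
(* Brauer's lemma is applied with trivial [K], so that congruence is equality. *)
have xn : x ^+ absz n = phi (w ^+ absz n).
  have s1 : subgroup [set (1 : G)].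
    by split=> [//|_ _ -> ->|_ ->]; rewrite /= ?mulg1 ?invg1.
  have n1 g : normaliser [set (1 : G)] g.
    by move=> y; split=> [/= /eqP|->]; rewrite ?conj1g // conjg_eq1 => /eqP.
  have [||t Ct] :=
    @expg_coset_conj G [set 1] C (phi w) c (absz n) s1 sC _ (n1 _)
      (@phi_core_normal _ _ _) (fun x _ => n1 x) _ Cc.
  - by move=> _ ->; exact: C1.
  - have -> : quotient_set C [set 1] = (fun a : G => [set a]) @` C.
      by apply: eq_imagel => a _; rewrite lcoset_set1.
    apply: (card_eq_dvd_l (A := C)); last first.
      by apply: dvd_card_trans An; apply: dvd_card_subgroup => //; exact: phi_core_sub.
    rewrite card_eq_sym; apply: inj_card_eq => a b _ _ /seteqP[+ _].
    by move/(_ a erefl).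
  - rewrite lcoset_set1 => ->.
    move/phi_coreE: Ct => [_ /(_ (w ^+ absz n))].
    have -> : deg (w ^+ absz n) = 0%R by rewrite degX pmulrn; apply/w_ord; rewrite dvdzE.
    by rewrite homX => /(_ erefl) tC; rewrite conjgE -tC mulKg.
have xker i : (deg w *~ i = 0)%R -> zpow x i = phi (zpow w i).
  have xpow : zpow x n = phi (zpow w n).
    by move: xn; case: (n) => m /=; rewrite ?homV => ->.
  by move/w_ord/dvdzP => [q ->]; rewrite mulrC !zpowM xpow !hom_zpow.
have xJ1 f : deg f = 0%R -> phi f ^ x = phi (f ^ w).
  move=> f0; rewrite conjgM -homJ conjgE.
  have /phi_coreE[_ /(_ (f ^ w))] := Cc; rewrite degJ => /(_ f0).
  by rewrite /commute => <-; rewrite mulKg.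
have xJ i f : deg f = 0%R -> phi f ^ zpow x i = phi (f ^ zpow w i).
  move=> f0; elim/int_ind: i => [|m IH|m IH]; first by rewrite !conjg1.
    by rewrite intS addrC !zpowS [in LHS]conjgM [in RHS]conjgM IH xJ1 ?degJ.
  apply: (@conjg_inj _ x); rewrite xJ1 ?degJ // -!conjgM -!zpowS.
  by rewrite intS opprD [(-1 + _)%R]addrC subrK.
have /choice[J JP] : forall f, exists j : int, deg f = (deg w *~ j)%R by [].
(* Extend [w |-> x] along [f = w ^ j * f0] with [deg f0 = 0]. *)
pose psi f := zpow x (J f) * phi (zpow w (- J f)%R * f).
(* The value is independent of the integer representing the degree: two choices differ by an
   exponent to which [xker] applies. *)
have psiE f j : deg f = (deg w *~ j)%R -> psi f = zpow x j * phi (zpow w (- j)%R * f).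
  move=> fj; have Ji : J f = (j + (J f - j))%R by rewrite addrC subrK.
  rewrite /psi {1}Ji zpowD [zpow x (J f - j)%R]xker; last first.
    by rewrite mulrzBr -JP fj subrr.
  by rewrite -mulgA -gmulfM mulgA -zpowD addrAC subrr sub0r.
have psiM : {morph psi : f g / f * g}.
  move=> f g; rewrite (psiE (f * g) (J f + J g)%R); last by rewrite degM mulrzDr -!JP.
  have f0 : deg (zpow w (- J f)%R * f) = 0%R.
    by rewrite degM deg_zpow mulrNz -JP addNr.
  rewrite /psi -!mulgA [X in _ = _ * X]mulgA [X in _ = _ * (X * _)]conjgC xJ // zpowD -!mulgA -gmulfM.
  congr (_ * (_ * phi _)).
  by rewrite opprD addrC zpowD !zpowN conjgE -!mulgA mulVKg.
pose psi' : {multiplicative F -> G} :=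
  Multiplicative.Pack (Multiplicative.Class (isMultiplicative.Build F G psi psiM)).
have psi0 f : deg f = 0%R -> psi' f = phi f.
  by move=> f0; rewrite /= (psiE f 0%R) ?oppr0 ?mul1g.
have psiw : psi' w = x.
  by rewrite /= (psiE w 1%R) // zpowN /= !expg1 mulVg hom1 mulg1.
exists psi' => //; split=> // f.
apply: (@degree_subgroup [set f | lcoset (phi f) C (psi' f)] w) => //.
- by apply: subgroup_hom_lcoset => //; exact: phi_core_normal.
- by move=> g g0; apply/lcosetE; rewrite psi0 // mulVg.
- by apply/lcosetE; rewrite psiw mulKg.
Qed.

(* The bijection sends [a = c r], where [r] represents the coset [A_phi a], to
   the conjugate by [r] of the homomorphism similar to [phi] determined by [c]. *)
Lemma card_similar_conj_class A phi w :
  (forall z, exists j : int, z = (deg w *~ j)%R) ->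
  (forall j, (deg w *~ j = 0)%R <-> (n %| j)%Z) ->
  subgroup A -> dvd_card A `I_(absz n) ->
  [set psi | exists2 h, A h & similar A (conjh phi h) psi] #= A.
Proof.
move=> w_gen w_ord sA An; have [A1 AM AV] := sA.
set C := phi_core deg phi A; have sC : subgroup C by exact: subgroup_phi_core.
have [C1 CM CV] := sC; have CA : C `<=` A by exact: phi_core_sub.
(* Outside [C] the value of [tw] is the default [phi]. *)
have /choice[tw twP] : forall c, exists psi,
    C c -> similar A phi psi /\ psi w = phi w * c.
  move=> c; have [Cc|nCc] := pselect (C c); last by exists phi.
  by have [psi s e] := similar_exists w_gen w_ord sA An Cc; exists psi.
(* A representative of the right coset [C a]; the default [1] is never taken, as [a] itself
   qualifies. *)
pose rep a := xget 1 [set b | C (b * a^-1)].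
have repP a : C (rep a * a^-1).
  by rewrite /rep; case: xgetP => [b -> //|/(_ a)]; rewrite /= mulgV.
have repPV a : C (a * (rep a)^-1) by have := CV _ (repP a); rewrite invgM invgK.
have repA a : A a -> A (rep a).
  by move=> Aa; have := AM _ _ (CA _ (repP a)) Aa; rewrite mulgVK.
have repE a b : C (a * b^-1) -> rep a = rep b.
  move=> Cab; congr (xget 1 _); apply/seteqP; split=> x /= Cx.
    by have := CM _ _ Cx Cab; rewrite mulgA mulgVK.
  by have := CM _ _ Cx (CV _ Cab); rewrite invgM invgK mulgA mulgVK.
pose T a := conjh (tw (a * (rep a)^-1)) (rep a).
have -> : [set psi | exists2 h, A h & similar A (conjh phi h) psi] = T @` A.
  apply/seteqP; split=> [psi [h Ah s]|_ [a Aa <-]]; last first.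
    exists (rep a); first exact: repA.
    by apply: similar_conj => //; [exact: repA | have [] := twP _ (repPV a)].
  set r := rep h; have Ar : A r by exact: repA.
  (* Since [h * r^-1] lies in [C], conjugating [phi] by it stays in the class of [phi]. *)
  have : similar A phi (conjh psi r^-1).
    apply: (@similar_trans _ sA (conjh phi (h * r^-1))).
      by apply/similar_conj_core => //; [apply: AM => //; exact: AV | exact: repPV].
    by rewrite -conjhM; apply: similar_conj => //; exact: AV.
  set chi := conjh psi r^-1 => s'; have [chi0 /(_ w)/lcosetE Cc] := s'.
  set c := _ * chi w in Cc.
  exists (c * r); first by apply: AM => //; exact: CA.
  have rE : rep (c * r) = r.
    transitivity (rep r); first by apply: repE; rewrite mulgK.
    by apply: repE; exact: repP.
  rewrite /T rE mulgK.
  have [[tw0 _] tww] := twP _ Cc.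
  suff -> : tw c = chi by rewrite conjhK.
  apply: hom_eq => f.
  apply: (@degree_subgroup [set f | tw c f = chi f] w) => //.
  - split=> [|g g' /= e e'|g /= e]; first by rewrite /= !hom1.
      by rewrite !gmulfM e e'.
    by rewrite !homV e.
  - by move=> g g0 /=; rewrite tw0 // chi0.
  - by rewrite /= tww mulVKg.
apply: inj_card_eq => a b; rewrite !inE => Aa Ab Tab.
have [sa wa] := twP _ (repPV a); have [sb wb] := twP _ (repPV b).
have Ars : A (rep a * (rep b)^-1) by apply: AM; [|apply: AV]; exact: repA.
(* Equal images make [rep a * (rep b)^-1] stabilise the class of [phi], so both representatives
   belong to one coset and coincide. *)
have Crs : C (rep a * (rep b)^-1).
  apply/(similar_conj_core sA phi Ars).
  apply: (@similar_trans _ sA (tw (b * (rep b)^-1))) => //.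
  apply: similar_sym => //.
  have -> : tw (b * (rep b)^-1) = conjh (tw (a * (rep a)^-1)) (rep a * (rep b)^-1).
    by rewrite -conjhM -/(T a) Tab /T conjhM mulgV conjh1.
  exact: similar_conj.
have rab : rep a = rep b.
  apply: repE; have := CM _ _ (repPV a) (CM _ _ Crs (repP b)).
  by rewrite !mulgA mulgVK mulgVK.
have twab : tw (a * (rep a)^-1) = tw (b * (rep b)^-1).
  by rewrite -[LHS]conjh1 -(mulgV (rep a)) -conjhM -/(T a) Tab /T rab conjhM mulgV conjh1.
have : phi w * (a * (rep a)^-1) = phi w * (b * (rep b)^-1) by rewrite -wa -wb twab.
by move/mulgI; rewrite rab => /mulIg.
Qed.

(** Condition (ii) applies to a conjugate of [psi] by some [t^-1], and condition (i) brings the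
    result back to [psi]. *)
Lemma similar_closed (H K : set G) phi psi (k : nat) (Phi : set {multiplicative F -> G}) w :
  (forall z, exists j : int, z = (deg w *~ j)%R) ->
  subgroup H ->
  (forall phi h, Phi phi -> H h -> Phi (conjh phi h)) ->
  K `<=` phi_core deg phi H ->
  normal_in K (generated (phi_core deg phi H `|` range phi)) ->
  dvd_card (quotient_set (phi_core deg phi H) K) `I_k ->
  (forall psi : {multiplicative F -> G},
     (forall f : F, deg f = 0%R -> psi f = phi f) ->
     (forall f : F, (exists z : Zmod n, deg f = (z *+ k)%R) ->
        lcoset (phi f) K (psi f)) ->
     Phi psi) ->
  similar H phi psi -> Phi psi.
Proof.
move=> w_gen sH PhiJ KC [sK _ nK] dk PhiK [psi0 psiC].
set C := phi_core deg phi H in KC dk psiC.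
have sC : subgroup C by exact: subgroup_phi_core.
have {}nK x : (C `|` range phi) x -> normaliser K x.
  by move=> Cx; apply: conjset_normaliser; apply: nK; exact: sub_gen_smallest.
have nKphi f : normaliser K (phi f) by apply: nK; right; exists f.
(* Here [v = phi w] and [u = (phi w)^-1 * psi w], so [v * u] is [psi w]. *)
have [t Ct] := expg_coset_conj sK sC KC (nKphi w) (@phi_core_normal phi H w)
  (fun x Cx => nK x (or_introl Cx)) dk (iffLR (lcosetE _ _ _) (psiC w)).
rewrite mulVKg => wt; have [_ _ CV] := sC; have [_ _ KV] := sK.
have Ht : H t by exact: phi_core_sub Ct.
rewrite -(conjhK psi t); apply: PhiJ => //; apply: PhiK.
  move=> f f0; rewrite /= /conj_hom psi0 //.
  have /phi_coreE[_ /(_ f f0) tC] := CV _ Ct.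
  by rewrite conjgE -tC mulKg.
move=> f; pose S := [set f | lcoset (phi f) K (conjh psi t^-1 f)].
apply: (@degree_multiple_subgroup S w k) => //.
- exact: subgroup_hom_lcoset.
- move=> g g0; apply/lcosetE; rewrite /= /conj_hom psi0 //.
  have /phi_coreE[_ /(_ g g0) tC] := CV _ Ct.
  by rewrite [_ ^ t^-1]conjgE -tC mulKg mulVg; case: sK.
- apply/lcosetE; move/lcosetE: wt.
  rewrite /= /conj_hom !homX => wt; apply/(nK t (or_introl Ct)).
  by rewrite conjMg conjgKV conjVg.
Qed.

End Indexed.

(** * Partition of [Phi] into sets of cardinality [|A|] *)

Theorem mainTheorem3 (n : int) (F G : groupType) (deg : F -> Zmod n)
    (deg_epi : is_degree deg)
    (H : set G) (sH : subgroup H)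
    (k : nat) (k_gt0 : (0 < k)%N)
    (Phi : set {multiplicative F -> G})
    (Phi_conj : forall (phi : {multiplicative F -> G}) (h : G),
       Phi phi -> H h -> Phi (conj_hom phi h))
    (Phi_core : forall phi : {multiplicative F -> G}, Phi phi ->
       exists K : set G,
         [/\ K `<=` phi_core deg phi H,
             normal_in K (generated (phi_core deg phi H `|` range phi)),
             dvd_card (quotient_set (phi_core deg phi H) K) `I_k
           & forall psi : {multiplicative F -> G},
               (forall f : F, deg f = 0%R -> psi f = phi f) ->
               (forall w : F, (exists z : Zmod n, deg w = (z *+ k)%R) ->
                  lcoset (phi w) K (psi w)) ->
               Phi psi]) :
  dvd_card [set: GCD sH n] Phi.
Proof.
have [degM degS] := deg_epi.
have [e e_gen e_ord] := Zmod_cyclic n; have [w we] := degS e.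
rewrite -we in e_gen e_ord.
have [_ univ] := GCDP sH n.
(* The universal property speaks of types, so [Phi] is replaced by its subtype and then restored,
   leaving a single subgroup [A]. *)
apply: (card_eq_dvd_r (card_setT Phi)); apply: univ => A [sA AH An].
apply: (card_eq_dvd_r (card_setT_sym Phi)).
have [A1 AM AV] := sA.
(* Similarity over [A] implies similarity over [H], the core being monotone in the subgroup. *)
have sim_Phi phi psi : Phi phi -> similar deg A phi psi -> Phi psi.
  move=> Pphi [psi0 psiA]; have [K [KC nK dk PhiK]] := Phi_core _ Pphi.
  apply: (similar_closed degM e_gen sH Phi_conj KC nK dk PhiK); split=> // f.
  by have [c Ac <-] := psiA f; exists c => //; exact: phi_coreS Ac.
pose cl (phi : {multiplicative F -> G}) :=
  [set psi | exists2 h, A h & similar deg A (conjh phi h) psi].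
apply: (@dvd_card_classes _ _ _ _ cl) => [phi _|phi psi Pphi [h Ah s]|phi _].
- by exists 1 => //; rewrite conjh1; exact: similar_refl.
- split; first by apply: sim_Phi s; apply: Phi_conj => //; exact: AH.
  apply/seteqP; split=> chi [g Ag sg].
    exists (h * g); first exact: AM.
    apply: similar_trans sg => //.
    by rewrite -conjhM; exact: similar_conj.
  exists (h^-1 * g); first by apply: AM => //; exact: AV.
  apply: similar_trans sg => //; rewrite -conjhM; apply: similar_conj => //.
  apply: similar_sym => //.
  rewrite -[phi]conjh1 -(mulgV h) -conjhM.
  by apply: similar_conj => //; exact: AV.
- exact: card_similar_conj_class e_gen e_ord sA An.
Qed.
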